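(* For every real $\alpha$ with $|\alpha|\le 1$, $$\int_0^1\frac{(\arctan(\alpha x))^2}{1+x^2}\,dx=\sum_{n=1}^\infty\frac{h_n}{n}\left(\sum_{k=1}^n\frac{(-1)^{k-1}}{2k-1}-\frac{\pi}{4}\right)\alpha^{2n}.$$ In particular, when $\alpha=1$, $$\pi^3=192\sum_{n=1}^\infty\frac{h_n}{n}\left(\sum_{k=1}^n\frac{(-1)^{k-1}}{2k-1}-\frac{\pi}{4}\right).$$
   Context: For $n\ge 1$, $h_n=\sum_{k=1}^n\frac{1}{2k-1}=1+\frac13+\frac15+\cdots+\frac{1}{2n-1}$ (and $h_0=0$). *)

(* Defs.v *)
From Stdlib Require Import Reals.
From Coquelicot Require Import Coquelicot.
Open Scope R_scope.

(* [sum_n_m a 1 0] is the empty sum, so [h 0 = 0]. *)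
Definition h (n : nat) : R := sum_n_m (fun k => 1 / (2 * INR k - 1)) 1 n.

(* The exponent [k - 1] is a truncated subtraction on [nat]; only k >= 1 occurs. *)
Definition leibniz_sum (n : nat) : R :=
  sum_n_m (fun k => (-1) ^ (k - 1) / (2 * INR k - 1)) 1 n.

Definition coef (n : nat) : R := h n / INR n * (leibniz_sum n - PI / 4).

(* Main.v *)
Require Import Defs.
From Stdlib Require Import Reals Lra Lia.
From Coquelicot Require Import Coquelicot.
Open Scope R_scope.

(* The Taylor polynomials P of [atan] and Q of [atan ^ 2] satisfy
   P' = (1 +- y^(2N)) / (1 + y^2) and (1 + y^2) Q' = 2 P +- 2 h_N y^(2N+1)
   exactly.  Comparing derivatives twice therefore bounds the error of Q on all of
   [-1, 1], endpoints included, by h_(N+1) / (N+1), which tends to 0.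
   Integrating Q (alpha x) / (1 + x^2) term by term yields the partial sums of the
   series, because the moments of 1 / (1 + x^2) satisfy
   I_(n+1) + I_n = 1 / (2n+1) with I_0 = PI / 4. *)

(* The Coquelicot operations and their carrier, unfolded so that [ring] and [field]
   recognize [R]. *)
Ltac unfold_R :=
  unfold minus;
  repeat match goal with
  | |- context [@plus ?G ?x ?y] => change (@plus G x y) with (Rplus x y)
  | |- context [@opp ?G ?x] => change (@opp G x) with (Ropp x)
  | |- context [@scal ?K ?V ?x ?y] => change (@scal K V x y) with (Rmult x y)
  end;
  try match goal with |- @eq _ ?x ?y => change (@eq R x y) end.

(** * Recurrences and growth of the odd harmonic sums and the partial Leibniz sums *)

Lemma h_0 : h 0 = 0.
Proof. unfold h. rewrite sum_n_m_zero; [reflexivity | lia]. Qed.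

Lemma h_S (n : nat) : h (S n) = h n + 1 / (2 * INR n + 1).
Proof.
  unfold h. rewrite sum_n_Sm by lia. unfold_R.
  rewrite S_INR. f_equal. f_equal. ring.
Qed.

Lemma leibniz_sum_0 : leibniz_sum 0 = 0.
Proof. unfold leibniz_sum. rewrite sum_n_m_zero; [reflexivity | lia]. Qed.

Lemma leibniz_sum_S (n : nat) :
  leibniz_sum (S n) = leibniz_sum n + (-1) ^ n / (2 * INR n + 1).
Proof.
  unfold leibniz_sum. rewrite sum_n_Sm by lia. unfold_R.
  rewrite S_INR. replace (S n - 1)%nat with n by lia. f_equal. f_equal. ring.
Qed.

Lemma h_bounds (n : nat) : 0 <= h n <= INR n.
Proof.
  induction n as [|n IH].
  - rewrite h_0. simpl. lra.
  - rewrite h_S, S_INR. pose proof (pos_INR n).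
    assert (0 < 1 / (2 * INR n + 1) <= 1).
    { split; [apply Rdiv_lt_0_compat; lra|].
      apply Rle_div_l; lra. }
    lra.
Qed.

(** The linear bound on [h] is too weak for [h n / INR n] to tend to 0; square-root growth suffices.
    With [d = 1 / (2n+1)] and [h n <= n], the increment of the square is [2 d h n + d^2 <= 2 n d +
    d^2 = 1 - d + d^2 <= 1]. *)
Lemma h_sqr_le (n : nat) : h n ^ 2 <= 2 * INR n.
Proof.
  induction n as [|n IH].
  - rewrite h_0. simpl. lra.
  - rewrite h_S, S_INR. pose proof (pos_INR n) as Hn. pose proof (h_bounds n).
    set (d := 1 / (2 * INR n + 1)).
    assert (Hd : d * (2 * INR n + 1) = 1) by (unfold d; field; lra).
    assert (0 < d) by (apply Rdiv_lt_0_compat; lra).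
    assert (d <= 1) by nra.
    nra.
Qed.

Lemma is_lim_seq_h_div : is_lim_seq (fun n => h (S n) / INR (S n)) 0.
Proof.
  apply is_lim_seq_spec. intros eps.
  (* The choice [1 / N < eps^2 / 2] gives [2 < eps^2 m] for all [m >= N], whereas [h m >= eps m]
     would force [eps^2 m^2 <= h m ^ 2 <= 2 m]. *)
  destruct (archimed_cor1 (eps ^ 2 / 2)) as [N [HN HN0]].
  { pose proof (cond_pos eps). nra. }
  exists N. intros n Hn.
  pose proof (cond_pos eps) as He.
  pose proof (lt_0_INR N HN0) as HNp.
  assert (HSn : INR N <= INR (S n)) by (apply le_INR; lia).
  pose proof (h_sqr_le (S n)) as Hsq. pose proof (h_bounds (S n)) as Hb.
  rewrite Rminus_0_r, Rabs_pos_eq by (apply Rdiv_le_0_compat; lra).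
  apply Rlt_div_l; [lra|].
  assert (2 < eps ^ 2 * INR N).
  { apply (Rmult_lt_compat_r (INR N)) in HN; [|lra].
    rewrite Rinv_l in HN by lra. lra. }
  set (m := INR (S n)) in *. set (e := pos eps) in *.
  assert (2 < e ^ 2 * m) by nra.
  apply Rnot_le_lt. intros Hc.
  assert ((e * m) ^ 2 <= h (S n) ^ 2) by (apply pow_incr; split; [apply Rmult_le_pos; lra | lra]).
  nra.
Qed.

(** Both [g - f] and [g + f] vanish at 0 and have a nonnegative derivative to the right of it, so
    the mean value theorem makes them nonnegative at [y]. *)
Lemma abs_le_of_derive_le (f g df dg : R -> R) (y : R) :
  0 <= y ->
  (forall x, is_derive f x (df x)) -> (forall x, is_derive g x (dg x)) ->
  f 0 = 0 -> g 0 = 0 ->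
  (forall x, 0 <= x -> Rabs (df x) <= dg x) ->
  Rabs (f y) <= g y.
Proof.
  intros Hy Hf Hg Hf0 Hg0 Hle.
  assert (Hmono : forall u du, (forall x, is_derive u x (du x)) -> u 0 = 0 ->
      (forall x, 0 <= x -> 0 <= du x) -> 0 <= u y).
  { intros u du Hu Hu0 Hdu.
    destruct (MVT_gen u 0 y du) as [c [Hc Heq]].
    - intros x _. apply Hu.
    - intros x _. apply continuity_pt_filterlim, (ex_derive_continuous u).
      exists (du x). apply Hu.
    - rewrite Rmin_left, Rmax_right in Hc by lra.
      pose proof (Hdu c ltac:(lra)). nra. }
  assert (0 <= g y - f y).
  { apply (Hmono (fun x => g x - f x) (fun x => dg x - df x)).
    - intros x. apply (is_derive_minus g f); auto.
    - lra.
    - intros x Hx. pose proof (Rle_abs (df x)). pose proof (Hle x Hx). lra. }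
  assert (0 <= g y + f y).
  { apply (Hmono (fun x => g x + f x) (fun x => dg x + df x)).
    - intros x. apply (is_derive_plus g f); auto.
    - lra.
    - intros x Hx. pose proof (Rabs_maj2 (df x)). pose proof (Hle x Hx). lra. }
  apply Rabs_le. lra.
Qed.

(** * Taylor polynomials of [atan] and [atan ^ 2], with their exact derivatives *)

Definition atan_poly (N : nat) (y : R) : R :=
  sum_n (fun m => (-1) ^ m / (2 * INR m + 1) * y ^ (2 * m + 1)) N.

(** The coefficients are those of the Cauchy square of the arctangent series. [N] is the last index,
    so the degree is [2N+2]. *)
Definition atan_sqr_poly (N : nat) (y : R) : R :=
  sum_n (fun m => (-1) ^ m * (h (S m) / INR (S m)) * y ^ (2 * S m)) N.

Lemma is_derive_scal_pow (c : R) (n : nat) (y : R) :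
  is_derive (fun x => c * x ^ n) y (c * INR n * y ^ pred n).
Proof. auto_derive; trivial; ring. Qed.

Lemma INR_double (m : nat) : INR (2 * m) = 2 * INR m.
Proof. rewrite mult_INR. simpl. ring. Qed.

Lemma is_derive_atan (y : R) : is_derive atan y (/ (1 + y ^ 2)).
Proof. apply is_derive_Reals, derivable_pt_lim_atan. Qed.

(** Differentiation turns the sum into a finite geometric sum of ratio [- y^2], here in closed
    form. *)
Lemma is_derive_atan_poly (N : nat) (y : R) :
  is_derive (atan_poly N) y ((1 + (-1) ^ N * y ^ (2 * S N)) / (1 + y ^ 2)).
Proof.
  assert (H1 : 1 + y ^ 2 <> 0) by nra.
  induction N as [|N IH].
  - apply is_derive_ext with (fun x => 1 * x ^ 1).
    { intros x. unfold atan_poly. rewrite sum_O. simpl. field. }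
    replace ((1 + (-1) ^ 0 * y ^ (2 * 1)) / (1 + y ^ 2)) with (1 * INR 1 * y ^ pred 1)
      by (simpl; field; nra).
    apply is_derive_scal_pow.
  - set (a := (-1) ^ S N / (2 * INR (S N) + 1)).
    apply is_derive_ext with (fun x => atan_poly N x + a * x ^ (2 * S N + 1)).
    { intros x. unfold atan_poly. rewrite sum_Sn. reflexivity. }
    pose proof (pos_INR (S N)).
    replace ((1 + (-1) ^ S N * y ^ (2 * S (S N))) / (1 + y ^ 2))
      with ((1 + (-1) ^ N * y ^ (2 * S N)) / (1 + y ^ 2)
            + a * INR (2 * S N + 1) * y ^ pred (2 * S N + 1)).
    { apply (is_derive_plus (atan_poly N)); [exact IH | apply is_derive_scal_pow]. }
    rewrite plus_INR, INR_double.
    replace (pred (2 * S N + 1)) with (2 * S N)%nat by lia.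
    replace (2 * S (S N))%nat with (2 * S N + 2)%nat by lia.
    rewrite (pow_add y (2 * S N) 2).
    unfold a. change ((-1) ^ S N) with (-1 * (-1) ^ N). change (INR 1) with 1.
    field. split; [exact H1 | lra].
Qed.

(** The derivative has terms [2 (-1)^m h (S m) y^(2m+1)]. Multiplying by [1 + y^2] subtracts
    neighbouring coefficients, and [h (S m) - h m = 1 / (2m+1)] leaves twice the arctangent
    coefficient; only the top term, of degree [2N+3], survives uncancelled. *)
Lemma is_derive_atan_sqr_poly (N : nat) (y : R) :
  is_derive (atan_sqr_poly N) y
    (2 * (atan_poly N y + (-1) ^ N * h (S N) * y ^ (2 * N + 3)) / (1 + y ^ 2)).
Proof.
  assert (H1 : 1 + y ^ 2 <> 0) by nra.
  induction N as [|N IH].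
  - apply is_derive_ext with (fun x => 1 * x ^ 2).
    { intros x. unfold atan_sqr_poly. rewrite sum_O, h_S, h_0. simpl. field. }
    replace (2 * _ / _) with (1 * INR 2 * y ^ pred 2).
    { apply is_derive_scal_pow. }
    unfold atan_poly. rewrite sum_O, h_S, h_0. simpl. field. nra.
  - set (a := (-1) ^ S N * (h (S (S N)) / INR (S (S N)))).
    apply is_derive_ext with (fun x => atan_sqr_poly N x + a * x ^ (2 * S (S N))).
    { intros x. unfold atan_sqr_poly. rewrite sum_Sn. reflexivity. }
    replace (2 * (atan_poly (S N) y + _) / _)
      with (2 * (atan_poly N y + (-1) ^ N * h (S N) * y ^ (2 * N + 3)) / (1 + y ^ 2)
            + a * INR (2 * S (S N)) * y ^ pred (2 * S (S N))).
    { apply (is_derive_plus (atan_sqr_poly N)); [exact IH | apply is_derive_scal_pow]. }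
    rewrite INR_double.
    replace (pred (2 * S (S N))) with (2 * N + 3)%nat by lia.
    replace (2 * S N + 3)%nat with (2 * N + 3 + 2)%nat by lia.
    rewrite (pow_add y (2 * N + 3) 2).
    unfold a, atan_poly. rewrite sum_Sn. unfold_R.
    replace (2 * S N + 1)%nat with (2 * N + 3)%nat by lia.
    rewrite (h_S (S N)). change ((-1) ^ S N) with (-1 * (-1) ^ N).
    pose proof (pos_INR (S N)). rewrite (S_INR (S N)).
    field. repeat split; lra.
Qed.

Lemma atan_poly_0 (N : nat) : atan_poly N 0 = 0.
Proof.
  unfold atan_poly. induction N as [|N IH].
  - rewrite sum_O. simpl. ring.
  - rewrite sum_Sn, IH, pow_i by lia. unfold_R. simpl. ring.
Qed.

Lemma atan_sqr_poly_0 (N : nat) : atan_sqr_poly N 0 = 0.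
Proof.
  unfold atan_sqr_poly. induction N as [|N IH].
  - rewrite sum_O. simpl. ring.
  - rewrite sum_Sn, IH, pow_i by lia. unfold_R. simpl. ring.
Qed.

(** * Error bounds for the Taylor polynomials *)

Lemma Rabs_pow_m1_mult (N : nat) (x : R) : 0 <= x -> Rabs ((-1) ^ N * x) = x.
Proof. intros Hx. rewrite Rabs_mult, pow_1_abs, Rabs_pos_eq by exact Hx. ring. Qed.

Lemma Rdiv_1_plus_sqr_le (a y : R) : 0 <= a -> a / (1 + y ^ 2) <= a.
Proof. intros Ha. apply Rle_div_l; nra. Qed.

(** The error has derivative [x^(2N+2) / (1 + x^2)] up to sign, which is at most [x^(2N+2)], the
    derivative of the bound. *)
Lemma atan_poly_error (N : nat) (y : R) :
  0 <= y ->
  Rabs (atan y - atan_poly N y) <= / (2 * INR N + 3) * y ^ (2 * N + 3).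
Proof.
  intros Hy. pose proof (pos_INR N) as HN.
  apply (abs_le_of_derive_le (fun x => atan x - atan_poly N x)
    (fun x => / (2 * INR N + 3) * x ^ (2 * N + 3))
    (fun x => / (1 + x ^ 2) - (1 + (-1) ^ N * x ^ (2 * S N)) / (1 + x ^ 2))
    (fun x => / (2 * INR N + 3) * INR (2 * N + 3) * x ^ pred (2 * N + 3))).
  - exact Hy.
  - intros x. apply (is_derive_minus atan (atan_poly N)).
    + apply is_derive_atan.
    + apply is_derive_atan_poly.
  - intros x. apply is_derive_scal_pow.
  - rewrite atan_0, atan_poly_0. ring.
  - rewrite pow_i by lia. ring.
  - intros x Hx.
    rewrite plus_INR, INR_double. replace (INR 3) with 3 by (simpl; ring).
    replace (pred (2 * N + 3)) with (2 * S N)%nat by lia.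
    assert (0 < 1 + x ^ 2) by nra.
    pose proof (pow_le x (2 * S N) Hx) as Hp.
    replace (/ (1 + x ^ 2) - (1 + (-1) ^ N * x ^ (2 * S N)) / (1 + x ^ 2))
      with (- ((-1) ^ N * (x ^ (2 * S N) / (1 + x ^ 2)))) by (field; lra).
    rewrite Rabs_Ropp, Rabs_pow_m1_mult by (apply Rdiv_le_0_compat; lra).
    apply Rle_trans with (x ^ (2 * S N)); [apply Rdiv_1_plus_sqr_le; exact Hp|].
    right. field. lra.
Qed.

(** The derivative of the error is at most twice the sum of the arctangent error and the leftover
    [h (S N) x^(2N+3)]. Since [1 / (2N+3) + h (S N) = h (S (S N))], the two contributions add up
    exactly to the derivative of the bound. *)
Lemma atan_sqr_poly_error_nonneg (N : nat) (y : R) :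
  0 <= y ->
  Rabs (atan y ^ 2 - atan_sqr_poly N y)
    <= h (S (S N)) / INR (S (S N)) * y ^ (2 * S (S N)).
Proof.
  intros Hy. pose proof (pos_INR N) as HN.
  apply (abs_le_of_derive_le (fun x => atan x ^ 2 - atan_sqr_poly N x)
    (fun x => h (S (S N)) / INR (S (S N)) * x ^ (2 * S (S N)))
    (fun x => 2 * atan x * / (1 + x ^ 2)
      - 2 * (atan_poly N x + (-1) ^ N * h (S N) * x ^ (2 * N + 3)) / (1 + x ^ 2))
    (fun x => h (S (S N)) / INR (S (S N)) * INR (2 * S (S N)) * x ^ pred (2 * S (S N)))).
  - exact Hy.
  - intros x. apply (is_derive_minus (fun t => atan t ^ 2) (atan_sqr_poly N)).
    + replace (2 * atan x * / (1 + x ^ 2))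
        with (INR 2 * / (1 + x ^ 2) * atan x ^ pred 2) by (simpl; ring).
      apply is_derive_pow, is_derive_atan.
    + apply is_derive_atan_sqr_poly.
  - intros x. apply is_derive_scal_pow.
  - rewrite atan_0, atan_sqr_poly_0. ring.
  - rewrite pow_i by lia. ring.
  - intros x Hx.
    rewrite INR_double, (h_S (S N)).
    replace (pred (2 * S (S N))) with (2 * N + 3)%nat by lia.
    rewrite !S_INR.
    assert (0 < 1 + x ^ 2) by nra.
    pose proof (pow_le x (2 * N + 3) Hx) as Hp.
    pose proof (atan_poly_error N x Hx) as He.
    pose proof (h_bounds (S N)) as Hh.
    set (P := x ^ (2 * N + 3)) in *. set (A := atan x - atan_poly N x) in *.
    replace (2 * atan x * / (1 + x ^ 2)
        - 2 * (atan_poly N x + (-1) ^ N * h (S N) * P) / (1 + x ^ 2))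
      with ((2 * (A - (-1) ^ N * (h (S N) * P))) / (1 + x ^ 2))
      by (unfold A; field; lra).
    rewrite Rabs_div, (Rabs_pos_eq (1 + x ^ 2)) by lra.
    apply Rle_trans with (1 := Rdiv_1_plus_sqr_le _ x (Rabs_pos _)).
    rewrite Rabs_mult, (Rabs_pos_eq 2) by lra.
    pose proof (Rabs_triang A (- ((-1) ^ N * (h (S N) * P)))) as Ht.
    rewrite Rabs_Ropp, Rabs_pow_m1_mult in Ht by nra.
    apply Rle_trans with (2 * (/ (2 * INR N + 3) * P + h (S N) * P)).
    { unfold Rminus. lra. }
    right. field. lra.
Qed.

Lemma atan_sqr_poly_opp (N : nat) (y : R) : atan_sqr_poly N (- y) = atan_sqr_poly N y.
Proof.
  apply sum_n_ext. intros m.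
  rewrite !pow_mult. replace ((- y) ^ 2) with (y ^ 2) by ring. reflexivity.
Qed.

(** Both functions are even, so [y] may be replaced by [Rabs y], whose powers are at most 1. *)
Lemma atan_sqr_poly_error (N : nat) (y : R) :
  Rabs y <= 1 ->
  Rabs (atan y ^ 2 - atan_sqr_poly N y) <= h (S (S N)) / INR (S (S N)).
Proof.
  intros Hy.
  replace (atan y ^ 2 - atan_sqr_poly N y)
    with (atan (Rabs y) ^ 2 - atan_sqr_poly N (Rabs y)).
  2:{ unfold Rabs. destruct (Rcase_abs y); [|reflexivity].
      rewrite atan_opp, atan_sqr_poly_opp. ring. }
  apply Rle_trans with (1 := atan_sqr_poly_error_nonneg N _ (Rabs_pos y)).
  rewrite <- (Rmult_1_r (h (S (S N)) / INR (S (S N)))) at 2.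
  apply Rmult_le_compat_l.
  - apply Rdiv_le_0_compat; [apply h_bounds | apply lt_0_INR; lia].
  - rewrite <- (pow1 (2 * S (S N))). apply pow_incr. split; [apply Rabs_pos | exact Hy].
Qed.

(** * Moments of [1 / (1 + x^2)] and termwise integration *)

Lemma is_RInt_antiderivative (F f : R -> R) (a b l : R) :
  (forall x, is_derive F x (f x)) -> (forall x, continuous f x) ->
  F b - F a = l -> is_RInt f a b l.
Proof. intros HF Hf <-. apply (is_RInt_derive F); auto. Qed.

Lemma is_RInt_pow_0_1 (n : nat) : is_RInt (fun x => x ^ n) 0 1 (/ INR (S n)).
Proof.
  assert (Hn : INR (S n) <> 0) by (apply not_0_INR; lia).
  apply is_RInt_ext with (fun x => / INR (S n) * INR (S n) * x ^ pred (S n)).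
  { intros x _. unfold_R. simpl pred. field. exact Hn. }
  apply is_RInt_antiderivative with (fun x => / INR (S n) * x ^ S n).
  - intros x. apply is_derive_scal_pow.
  - intros x. apply (ex_derive_continuous (V := R_NormedModule)). auto_derive. trivial.
  - rewrite pow1, pow_i by lia. ring.
Qed.

Lemma continuous_inv_1_plus_sqr (x : R) : continuous (fun x => / (1 + x ^ 2)) x.
Proof.
  apply (ex_derive_continuous (V := R_NormedModule)). auto_derive. nra.
Qed.

(** Splitting [x^(2n+2) / (1 + x^2)] as [x^(2n) - x^(2n) / (1 + x^2)] gives the recurrence, which
    the alternating Leibniz sums solve. *)
Lemma is_RInt_moment (n : nat) :
  is_RInt (fun x => x ^ (2 * n) / (1 + x ^ 2)) 0 1 ((-1) ^ n * (PI / 4 - leibniz_sum n)).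
Proof.
  induction n as [|n IH].
  - apply is_RInt_ext with (fun x => / (1 + x ^ 2)).
    { intros x _. simpl pow at 2. unfold Rdiv. symmetry; apply Rmult_1_l. }
    apply is_RInt_antiderivative with atan.
    + apply is_derive_atan.
    + apply continuous_inv_1_plus_sqr.
    + rewrite atan_1, atan_0, leibniz_sum_0. simpl. ring.
  - apply is_RInt_ext with (fun x => minus (x ^ (2 * n)) (x ^ (2 * n) / (1 + x ^ 2))).
    { intros x _. replace (2 * S n)%nat with (2 * n + 2)%nat by lia.
      rewrite pow_add. unfold_R. field. nra. }
    replace ((-1) ^ S n * (PI / 4 - leibniz_sum (S n)))
      with (minus (/ INR (S (2 * n))) ((-1) ^ n * (PI / 4 - leibniz_sum n))).
    { apply (is_RInt_minus (V := R_NormedModule)); [apply is_RInt_pow_0_1 | exact IH]. }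
    rewrite leibniz_sum_S, S_INR, INR_double.
    unfold_R.
    pose proof (pos_INR n).
    (* The sign power is opaque to [field], so [1 / (2n+1)] is rewritten with its square as
       numerator. *)
    assert (Hs : (-1) ^ n * (-1) ^ n = 1).
    { rewrite <- Rpow_mult_distr. replace (-1 * -1) with 1 by ring. apply pow1. }
    change ((-1) ^ S n) with (-1 * (-1) ^ n).
    replace (/ (2 * INR n + 1)) with ((-1) ^ n * (-1) ^ n / (2 * INR n + 1)).
    { field. lra. }
    rewrite Hs. field. lra.
Qed.

(** The sign [(-1)^m] of the coefficient meets the sign [(-1)^(m+1)] of the moment of index [m+1];
    their product -1 turns [PI / 4 - leibniz_sum (S m)] into the factor occurring in [coef]. *)
Lemma is_RInt_atan_sqr_poly (alpha : R) (N : nat) :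
  is_RInt (fun x => atan_sqr_poly N (alpha * x) / (1 + x ^ 2)) 0 1
    (sum_n (fun m => coef (S m) * alpha ^ (2 * S m)) N).
Proof.
  assert (Hterm : forall m,
    is_RInt (fun x => (-1) ^ m * (h (S m) / INR (S m)) * (alpha * x) ^ (2 * S m)
                      / (1 + x ^ 2)) 0 1 (coef (S m) * alpha ^ (2 * S m))).
  { intros m.
    set (c := (-1) ^ m * (h (S m) / INR (S m)) * alpha ^ (2 * S m)).
    apply is_RInt_ext with (fun x => scal c (x ^ (2 * S m) / (1 + x ^ 2))).
    { intros x _. unfold_R.
      rewrite Rpow_mult_distr. unfold c, Rdiv. ring. }
    replace (coef (S m) * alpha ^ (2 * S m))
      with (scal c ((-1) ^ S m * (PI / 4 - leibniz_sum (S m)))).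
    { apply (is_RInt_scal (V := R_NormedModule)), is_RInt_moment. }
    unfold_R. unfold c, coef.
    assert (Hs : (-1) ^ m * (-1) ^ m = 1).
    { rewrite <- Rpow_mult_distr. replace (-1 * -1) with 1 by ring. apply pow1. }
    change ((-1) ^ S m) with (-1 * (-1) ^ m).
    transitivity ((-1) ^ m * (-1) ^ m * (h (S m) / INR (S m)
       * (leibniz_sum (S m) - PI / 4) * alpha ^ (2 * S m))); [ring|].
    rewrite Hs. ring. }
  induction N as [|N IH].
  - rewrite sum_O. eapply is_RInt_ext; [|apply (Hterm 0%nat)].
    intros x _. unfold atan_sqr_poly. rewrite sum_O. reflexivity.
  - rewrite sum_Sn. eapply is_RInt_ext;
      [|apply (is_RInt_plus (V := R_NormedModule)); [exact IH | apply (Hterm (S N))]].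
    intros x _. unfold atan_sqr_poly. rewrite sum_Sn.
    unfold_R. symmetry; apply Rmult_plus_distr_r.
Qed.

(** * Passage to the limit, and the closed form at [alpha = 1] *)

Lemma ex_RInt_atan_sqr (alpha : R) :
  ex_RInt (fun x : R => (atan (alpha * x)) ^ 2 / (1 + x ^ 2)) 0 1.
Proof.
  apply (ex_RInt_continuous (V := R_CompleteNormedModule)). intros x _.
  apply (continuous_mult (fun x => atan (alpha * x) ^ 2)).
  - apply (ex_derive_continuous (V := R_NormedModule)).
    exists (INR 2 * (alpha * / (1 + (alpha * x) ^ 2)) * atan (alpha * x) ^ pred 2).
    apply (is_derive_pow (fun t => atan (alpha * t))),
      (is_derive_comp atan (fun t => alpha * t)).
    + apply is_derive_atan.
    + auto_derive; trivial; ring.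
  - apply continuous_inv_1_plus_sqr.
Qed.

(** For [x] in [0, 1] the point [alpha * x] stays in [-1, 1], so the uniform error bound integrates
    to a bound on the distance from the partial sums to the integral, and squeezing concludes. *)
Lemma is_series_atan_sqr (alpha : R) :
  Rabs alpha <= 1 ->
  is_series (fun m : nat => coef (S m) * alpha ^ (2 * S m))
    (RInt (fun x : R => (atan (alpha * x)) ^ 2 / (1 + x ^ 2)) 0 1).
Proof.
  intros Ha.
  set (I := RInt _ 0 1). set (s := sum_n (fun m => coef (S m) * alpha ^ (2 * S m))).
  set (e := fun N => h (S (S N)) / INR (S (S N))).
  assert (Herr : forall N, Rabs (I - s N) <= e N).
  (* The factor [1 - 0] is the length of the interval in the norm estimate for integrals. *)
  { intros N. replace (e N) with ((1 - 0) * e N) by ring.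
    apply (norm_RInt_le_const (V := R_NormedModule)
      (fun x => minus (atan (alpha * x) ^ 2 / (1 + x ^ 2))
                      (atan_sqr_poly N (alpha * x) / (1 + x ^ 2)))).
    - lra.
    - intros x Hx. change (norm ?z) with (Rabs z).
      unfold_R.
      replace (_ + _) with ((atan (alpha * x) ^ 2 - atan_sqr_poly N (alpha * x))
                            / (1 + x ^ 2)) by (field; nra).
      rewrite Rabs_div, (Rabs_pos_eq (1 + x ^ 2)) by nra.
      apply Rle_trans with (1 := Rdiv_1_plus_sqr_le _ x (Rabs_pos _)).
      apply atan_sqr_poly_error.
      rewrite Rabs_mult, (Rabs_pos_eq x) by lra.
      pose proof (Rabs_pos alpha). nra.
    - apply (is_RInt_minus (V := R_NormedModule)).
      + apply (RInt_correct (V := R_CompleteNormedModule)), ex_RInt_atan_sqr.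
      + apply is_RInt_atan_sqr_poly. }
  assert (He : is_lim_seq e 0).
  (* [e] is the null sequence [h (S n) / INR (S n)] shifted by one index. *)
  { apply (is_lim_seq_incr_1 (fun n => h (S n) / INR (S n))), is_lim_seq_h_div. }
  change (is_lim_seq s I).
  apply is_lim_seq_le_le with (fun N => I - e N) (fun N => I + e N).
  - intros N. pose proof (proj1 (Rabs_le_between _ _) (Herr N)). lra.
  - replace (Finite I) with (Finite (I - 0)) by (f_equal; ring).
    apply is_lim_seq_minus'; [apply is_lim_seq_const | exact He].
  - replace (Finite I) with (Finite (I + 0)) by (f_equal; ring).
    apply is_lim_seq_plus'; [apply is_lim_seq_const | exact He].
Qed.

(** The antiderivative [atan x ^ 3 / 3] takes the value [(PI / 4)^3 / 3] at 1 and vanishes at 0. *)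
Lemma RInt_atan_sqr_1 :
  RInt (fun x : R => (atan (1 * x)) ^ 2 / (1 + x ^ 2)) 0 1 = PI ^ 3 / 192.
Proof.
  apply is_RInt_unique.
  apply is_RInt_ext with (fun x => atan x ^ 2 / (1 + x ^ 2)).
  { intros x _. rewrite Rmult_1_l. reflexivity. }
  apply is_RInt_antiderivative with (fun x => atan x ^ 3 / 3).
  - intros x.
    apply is_derive_ext with (fun t => scal (/ 3) (atan t ^ 3)).
    { intros t. unfold_R. unfold Rdiv. ring. }
    replace (atan x ^ 2 / (1 + x ^ 2))
      with (scal (/ 3) (INR 3 * / (1 + x ^ 2) * atan x ^ pred 3)).
    { apply (is_derive_scal (fun t => atan t ^ 3)), is_derive_pow, is_derive_atan. }
    unfold_R. simpl INR. simpl pred. field. nra.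
  - intros x. apply (continuous_mult (fun x => atan x ^ 2)).
    + apply (ex_derive_continuous (V := R_NormedModule)).
      eexists. apply is_derive_pow, is_derive_atan.
    + apply continuous_inv_1_plus_sqr.
  - rewrite atan_1, atan_0. field.
Qed.

(* Series over n >= 1 are indexed by m = n - 1. *)
Theorem proposition3 :
  (forall alpha : R, Rabs alpha <= 1 ->
     ex_RInt (fun x : R => (atan (alpha * x)) ^ 2 / (1 + x ^ 2)) 0 1 /\
     is_series (fun m : nat => coef (S m) * alpha ^ (2 * S m))
       (RInt (fun x : R => (atan (alpha * x)) ^ 2 / (1 + x ^ 2)) 0 1)) /\
  (ex_series (fun m : nat => coef (S m)) /\
   PI ^ 3 = 192 * Series (fun m : nat => coef (S m))).
Proof.
  split.
  { intros alpha Ha. split; [apply ex_RInt_atan_sqr | apply is_series_atan_sqr, Ha]. }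
  assert (H1 : is_series (fun m => coef (S m)) (PI ^ 3 / 192)).
  { rewrite <- RInt_atan_sqr_1.
    apply is_series_ext with (fun m => coef (S m) * 1 ^ (2 * S m)).
    { intros m. rewrite pow1. apply Rmult_1_r. }
    apply is_series_atan_sqr. rewrite Rabs_R1. lra. }
  split.
  - exists (PI ^ 3 / 192). exact H1.
  - rewrite (is_series_unique _ _ H1). field.
Qed.
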